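(* Let $\mathsf{C}$ be a cartesian monoidal category (a category with finite products, regarded as a symmetric monoidal category with tensor product the categorical product $\times$, unit the terminal object $1$, and the canonical symmetry), and let $(P,\delta,E)$ be a monad on $\mathsf{C}$ which is affine, i.e. $P(1)\cong 1$. Then a bimonoidal monad structure on $(P,\delta,E)$ is the same thing as a monoidal monad structure on $(P,\delta,E)$: the assignment $(\eta,\nabla,\epsilon,\Delta)\mapsto(\eta,\nabla)$, forgetting the oplax part, is a bijection from the set of bimonoidal monad structures on $(P,\delta,E)$ to the set of monoidal monad structures on $(P,\delta,E)$.
   Context: A lax monoidal structure $(\eta,\nabla)$ on an endofunctor $P$ of a monoidal category consists of a unit $\eta:1\to P(1)$ and a natural multiplication $\nabla_{X,Y}:PX\otimes PY\to P(X\otimes Y)$ satisfying the usual associativity and unitality axioms. An oplax monoidal structure $(\epsilon,\Delta)$ consists, dually, of a counit $\epsilon:P(1)\to 1$ and a natural comultiplication $\Delta_{X,Y}:P(X\otimes Y)\to PX\otimes PY$ satisfying coassociativity and counitality. For $P$ an endofunctor of a braided monoidal category, a bilax monoidal (= bimonoidal) structure is a quadruple $(\eta,\nabla,\epsilon,\Delta)$ with $(\eta,\nabla)$ lax and $(\epsilon,\Delta)$ oplax, such that: (i) (bimonoidality) for all $W,X,Y,Z$ the two composites $P(W\otimes X)\otimes P(Y\otimes Z)\to P(W\otimes Y)\otimes P(X\otimes Z)$ agree: $$\Delta_{W\otimes Y,X\otimes Z}\circ P(\mathrm{id}_W\otimes \beta_{X,Y}\otimes \mathrm{id}_Z)\circ\nabla_{W\otimes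 X,Y\otimes Z}=(\nabla_{W,Y}\otimes\nabla_{X,Z})\circ(\mathrm{id}\otimes\beta_{PX,PY}\otimes\mathrm{id})\circ(\Delta_{W,X}\otimes\Delta_{Y,Z}),$$ where $\beta$ is the braiding and associators are suppressed; (ii) (unit/counit conditions) $\epsilon\circ\eta=\mathrm{id}_1$; the composite $1\xrightarrow{\eta}P(1)\cong P(1\otimes 1)\xrightarrow{\Delta_{1,1}}P(1)\otimes P(1)$ equals $1\cong 1\otimes 1\xrightarrow{\eta\otimes\eta}P(1)\otimes P(1)$; and the composite $P(1)\otimes P(1)\xrightarrow{\nabla_{1,1}}P(1\otimes 1)\cong P(1)\xrightarrow{\epsilon}1$ equals $P(1)\otimes P(1)\xrightarrow{\epsilon\otimes\epsilon}1\otimes 1\cong 1$. A monoidal monad structure on a monad $(P,\delta,E)$ (unit $\delta:\mathrm{id}\Rightarrow P$, multiplication $E:PP\Rightarrow P$) is a lax monoidal structure $(\eta,\nabla)$ on $P$ for which $\delta$ and $E$ are lax monoidal natural transformations, where $PP$ carries the composite lax structure (with multiplication $P(\nabla_{X,Y})\circ\nabla_{PX,PY}$). A bimonoidal monad structure on $(P,\delta,E)$ is a bilax monoidal structure on $P$ for which $\delta$ and $E$ are both lax and oplax monoidal natural transformations, where $PP$ carries the composite structures (with comultiplication $\Delta_{PX,PY}\circ P(\Delta_{X,Y})$). *)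

(* Defs.v *)
From mathcomp Require Import ssreflect ssrfun.

Set Implicit Arguments.
Unset Strict Implicit.
Unset Printing Implicit Defensive.

#[local] Obligation Tactic := idtac.

Reserved Notation "g ∘ f" (at level 40, left associativity).
Reserved Notation "X ⊗ Y" (at level 35, right associativity).

Record Category := {
  Ob :> Type;
  Hom : Ob -> Ob -> Type;
  idm : forall X, Hom X X;
  compose : forall X Y Z, Hom Y Z -> Hom X Y -> Hom X Z;
  compose_idl : forall X Y (f : Hom X Y), compose (idm Y) f = f;
  compose_idr : forall X Y (f : Hom X Y), compose f (idm X) = f;
  compose_assoc : forall W X Y Z (h : Hom Y Z) (g : Hom X Y) (f : Hom W X),
    compose h (compose g f) = compose (compose h g) f
}.

Arguments Hom {c}.
Arguments idm {c}.
Arguments compose {c X Y Z}.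

Notation "g ∘ f" := (compose g f).

Lemma compose_swap (C : Category) (X Y Y' Z : C) (g : Hom Y Z) (f : Hom X Y)
    (g' : Hom Y' Z) (f' : Hom X Y') :
  g ∘ f = g' ∘ f' -> forall W (h : Hom W X), g ∘ (f ∘ h) = g' ∘ (f' ∘ h).
Proof. by move=> e W h; rewrite !compose_assoc e. Qed.

Definition isomorphic (C : Category) (X Y : C) : Prop :=
  exists (f : Hom X Y) (g : Hom Y X), g ∘ f = idm X /\ f ∘ g = idm Y.

Record Functor (C D : Category) := {
  fobj :> C -> D;
  fmap : forall X Y, Hom X Y -> Hom (fobj X) (fobj Y);
  fmap_id : forall X, fmap (idm X) = idm (fobj X);
  fmap_comp : forall X Y Z (g : Hom Y Z) (f : Hom X Y),
    fmap (g ∘ f) = fmap g ∘ fmap f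
}.

Arguments fmap {C D} _ {X Y}.

Definition id_functor (C : Category) : Functor C C := {|
  fobj := fun X => X;
  fmap := fun X Y f => f;
  fmap_id := fun X => erefl;
  fmap_comp := fun X Y Z g f => erefl
|}.

Program Definition comp_functor (C D E : Category)
    (G : Functor D E) (F : Functor C D) : Functor C E := {|
  fobj := fun X => G (F X);
  fmap := fun X Y f => fmap G (fmap F f)
|}.
Next Obligation. by move=> C D E G F X /=; rewrite !fmap_id. Qed.
Next Obligation. by move=> C D E G F X Y Z g f /=; rewrite !fmap_comp. Qed.

Record NatTrans (C D : Category) (F G : Functor C D) := {
  component :> forall X, Hom (F X) (G X);
  naturality : forall X Y (f : Hom X Y),
    component Y ∘ fmap F f = fmap G f ∘ component X
}.

Record Monad (C : Category) := {
  monad_functor :> Functor C C;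
  monad_unit : NatTrans (id_functor C) monad_functor;
  monad_mult : NatTrans (comp_functor monad_functor monad_functor) monad_functor;
  monad_unitl : forall X, monad_mult X ∘ monad_unit (monad_functor X) = idm _;
  monad_unitr : forall X, monad_mult X ∘ fmap monad_functor (monad_unit X) = idm _;
  monad_assoc : forall X,
    monad_mult X ∘ monad_mult (monad_functor X)
    = monad_mult X ∘ fmap monad_functor (monad_mult X)
}.

Record MonoidalStructure (C : Category) := {
  tensor : C -> C -> C;
  tensor_hom : forall X X' Y Y', Hom X X' -> Hom Y Y' ->
    Hom (tensor X Y) (tensor X' Y');
  tensor_unit : C;
  assoc : forall X Y Z, Hom (tensor (tensor X Y) Z) (tensor X (tensor Y Z));
  assoc_inv : forall X Y Z, Hom (tensor X (tensor Y Z)) (tensor (tensor X Y) Z);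
  lunit : forall X, Hom (tensor tensor_unit X) X;
  lunit_inv : forall X, Hom X (tensor tensor_unit X);
  runit : forall X, Hom (tensor X tensor_unit) X;
  runit_inv : forall X, Hom X (tensor X tensor_unit);

  tensor_id : forall X Y, tensor_hom (idm X) (idm Y) = idm (tensor X Y);
  tensor_comp : forall X X' X'' Y Y' Y''
      (f' : Hom X' X'') (f : Hom X X') (g' : Hom Y' Y'') (g : Hom Y Y'),
    tensor_hom (f' ∘ f) (g' ∘ g) = tensor_hom f' g' ∘ tensor_hom f g;
  assoc_nat : forall X X' Y Y' Z Z' (f : Hom X X') (g : Hom Y Y') (h : Hom Z Z'),
    assoc X' Y' Z' ∘ tensor_hom (tensor_hom f g) h
    = tensor_hom f (tensor_hom g h) ∘ assoc X Y Z;
  assocK : forall X Y Z, assoc_inv X Y Z ∘ assoc X Y Z = idm _;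
  assoc_invK : forall X Y Z, assoc X Y Z ∘ assoc_inv X Y Z = idm _;
  lunit_nat : forall X Y (f : Hom X Y),
    lunit Y ∘ tensor_hom (idm tensor_unit) f = f ∘ lunit X;
  lunitK : forall X, lunit_inv X ∘ lunit X = idm _;
  lunit_invK : forall X, lunit X ∘ lunit_inv X = idm _;
  runit_nat : forall X Y (f : Hom X Y),
    runit Y ∘ tensor_hom f (idm tensor_unit) = f ∘ runit X;
  runitK : forall X, runit_inv X ∘ runit X = idm _;
  runit_invK : forall X, runit X ∘ runit_inv X = idm _;
  triangle : forall X Y,
    tensor_hom (idm X) (lunit Y) ∘ assoc X tensor_unit Y
    = tensor_hom (runit X) (idm Y);
  pentagon : forall W X Y Z,
    assoc W X (tensor Y Z) ∘ assoc (tensor W X) Y Z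
    = tensor_hom (idm W) (assoc X Y Z) ∘ assoc W (tensor X Y) Z
      ∘ tensor_hom (assoc W X Y) (idm Z)
}.

Arguments tensor_hom {C} _ {X X' Y Y'}.

Record BraidedStructure (C : Category) := {
  braided_monoidal :> MonoidalStructure C;
  braid : forall X Y,
    Hom (tensor braided_monoidal X Y) (tensor braided_monoidal Y X);
  braid_inv : forall X Y,
    Hom (tensor braided_monoidal Y X) (tensor braided_monoidal X Y);
  braid_nat : forall X X' Y Y' (f : Hom X X') (g : Hom Y Y'),
    braid X' Y' ∘ tensor_hom braided_monoidal f g
    = tensor_hom braided_monoidal g f ∘ braid X Y;
  braidK : forall X Y, braid_inv X Y ∘ braid X Y = idm _;
  braid_invK : forall X Y, braid X Y ∘ braid_inv X Y = idm _;
  hexagon : forall X Y Z,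
    assoc braided_monoidal Y Z X ∘ braid X (tensor braided_monoidal Y Z)
      ∘ assoc braided_monoidal X Y Z
    = tensor_hom braided_monoidal (idm Y) (braid X Z)
      ∘ assoc braided_monoidal Y X Z
      ∘ tensor_hom braided_monoidal (braid X Y) (idm Z);
  hexagon_inv : forall X Y Z,
    assoc_inv braided_monoidal Z X Y ∘ braid (tensor braided_monoidal X Y) Z
      ∘ assoc_inv braided_monoidal X Y Z
    = tensor_hom braided_monoidal (braid X Z) (idm Y)
      ∘ assoc_inv braided_monoidal X Z Y
      ∘ tensor_hom braided_monoidal (idm X) (braid Y Z)
}.

Record SymmetricStructure (C : Category) := {
  symmetric_braided :> BraidedStructure C;
  symmetry : forall X Y,
    braid symmetric_braided Y X ∘ braid symmetric_braided X Y = idm _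
}.

Section LaxOplax.

Variables (C : Category) (M : MonoidalStructure C).

Local Notation "X ⊗ Y" := (tensor M X Y).
Local Notation I := (tensor_unit M).
Local Notation "f [⊗] g" := (tensor_hom M f g) (at level 35).

Record LaxStructure (P : Functor C C) := {
  lax_unit : Hom I (P I);
  lax_mult : forall X Y, Hom (P X ⊗ P Y) (P (X ⊗ Y));
  lax_mult_nat : forall X X' Y Y' (f : Hom X X') (g : Hom Y Y'),
    lax_mult X' Y' ∘ (fmap P f [⊗] fmap P g) = fmap P (f [⊗] g) ∘ lax_mult X Y;
  lax_assoc : forall X Y Z,
    fmap P (assoc M X Y Z) ∘ lax_mult (X ⊗ Y) Z ∘ (lax_mult X Y [⊗] idm (P Z))
    = lax_mult X (Y ⊗ Z) ∘ (idm (P X) [⊗] lax_mult Y Z) ∘ assoc M (P X) (P Y) (P Z);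
  lax_unitl : forall X,
    fmap P (lunit M X) ∘ lax_mult I X ∘ (lax_unit [⊗] idm (P X)) = lunit M (P X);
  lax_unitr : forall X,
    fmap P (runit M X) ∘ lax_mult X I ∘ (idm (P X) [⊗] lax_unit) = runit M (P X)
}.

Record OplaxStructure (P : Functor C C) := {
  oplax_counit : Hom (P I) I;
  oplax_comult : forall X Y, Hom (P (X ⊗ Y)) (P X ⊗ P Y);
  oplax_comult_nat : forall X X' Y Y' (f : Hom X X') (g : Hom Y Y'),
    oplax_comult X' Y' ∘ fmap P (f [⊗] g)
    = (fmap P f [⊗] fmap P g) ∘ oplax_comult X Y;
  oplax_coassoc : forall X Y Z,
    assoc M (P X) (P Y) (P Z) ∘ (oplax_comult X Y [⊗] idm (P Z))
      ∘ oplax_comult (X ⊗ Y) Z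
    = (idm (P X) [⊗] oplax_comult Y Z) ∘ oplax_comult X (Y ⊗ Z)
      ∘ fmap P (assoc M X Y Z);
  oplax_counitl : forall X,
    lunit M (P X) ∘ (oplax_counit [⊗] idm (P X)) ∘ oplax_comult I X
    = fmap P (lunit M X);
  oplax_counitr : forall X,
    runit M (P X) ∘ (idm (P X) [⊗] oplax_counit) ∘ oplax_comult X I
    = fmap P (runit M X)
}.

Lemma tensor_compl X X' X'' Y (f' : Hom X' X'') (f : Hom X X') :
  (f' ∘ f) [⊗] idm Y = (f' [⊗] idm Y) ∘ (f [⊗] idm Y).
Proof. by rewrite -tensor_comp compose_idl. Qed.

Lemma tensor_compr X Y Y' Y'' (g' : Hom Y' Y'') (g : Hom Y Y') :
  idm X [⊗] (g' ∘ g) = (idm X [⊗] g') ∘ (idm X [⊗] g).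
Proof. by rewrite -tensor_comp compose_idl. Qed.

Program Definition id_lax : LaxStructure (id_functor C) := {|
  lax_unit := idm I;
  lax_mult := fun X Y => idm (X ⊗ Y)
|}.
Next Obligation. by move=> * /=; rewrite compose_idl compose_idr. Qed.
Next Obligation. by move=> * /=; rewrite !tensor_id !(compose_idl, compose_idr). Qed.
Next Obligation. by move=> * /=; rewrite tensor_id !compose_idr. Qed.
Next Obligation. by move=> * /=; rewrite tensor_id !compose_idr. Qed.

Program Definition id_oplax : OplaxStructure (id_functor C) := {|
  oplax_counit := idm I;
  oplax_comult := fun X Y => idm (X ⊗ Y)
|}.
Next Obligation. by move=> * /=; rewrite compose_idl compose_idr. Qed.
Next Obligation. by move=> * /=; rewrite !tensor_id !(compose_idl, compose_idr). Qed.
Next Obligation. by move=> * /=; rewrite tensor_id !compose_idr. Qed.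
Next Obligation. by move=> * /=; rewrite tensor_id !compose_idr. Qed.

Program Definition comp_lax (Q P : Functor C C)
    (q : LaxStructure Q) (p : LaxStructure P) :
    LaxStructure (comp_functor Q P) := {|
  lax_unit := fmap Q (lax_unit p) ∘ lax_unit q;
  lax_mult := fun X Y => fmap Q (lax_mult p X Y) ∘ lax_mult q (P X) (P Y)
|}.
Next Obligation.
move=> Q P q p X X' Y Y' f g /=.
by rewrite -compose_assoc lax_mult_nat !compose_assoc -!fmap_comp lax_mult_nat.
Qed.
Next Obligation.
move=> Q P q p X Y Z /=.
have nl := lax_mult_nat q (lax_mult p X Y) (idm (P Z)).
have nr := lax_mult_nat q (idm (P X)) (lax_mult p Y Z).
have ap := f_equal (fmap Q) (lax_assoc p X Y Z).
have aq := lax_assoc q (P X) (P Y) (P Z).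
move: nl nr ap aq; rewrite !fmap_comp !fmap_id => nl nr ap aq.
rewrite tensor_compl tensor_compr -!compose_assoc.
rewrite (compose_swap nl) (compose_swap nr) !compose_assoc ap -!compose_assoc.
by rewrite [X in _ = _ ∘ (_ ∘ X)]compose_assoc -aq !compose_assoc.
Qed.
Next Obligation.
move=> Q P q p X /=.
have nl := lax_mult_nat q (lax_unit p) (idm (P X)).
have up := f_equal (fmap Q) (lax_unitl p X).
move: nl up; rewrite !fmap_comp !fmap_id => nl up.
rewrite tensor_compl -!compose_assoc (compose_swap nl) !compose_assoc up.
exact: lax_unitl.
Qed.
Next Obligation.
move=> Q P q p X /=.
have nr := lax_mult_nat q (idm (P X)) (lax_unit p).
have up := f_equal (fmap Q) (lax_unitr p X).
move: nr up; rewrite !fmap_comp !fmap_id => nr up.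
rewrite tensor_compr -!compose_assoc (compose_swap nr) !compose_assoc up.
exact: lax_unitr.
Qed.

Program Definition comp_oplax (Q P : Functor C C)
    (q : OplaxStructure Q) (p : OplaxStructure P) :
    OplaxStructure (comp_functor Q P) := {|
  oplax_counit := oplax_counit q ∘ fmap Q (oplax_counit p);
  oplax_comult := fun X Y => oplax_comult q (P X) (P Y) ∘ fmap Q (oplax_comult p X Y)
|}.
Next Obligation.
move=> Q P q p X X' Y Y' f g /=.
by rewrite compose_assoc -oplax_comult_nat -!compose_assoc -!fmap_comp oplax_comult_nat.
Qed.
Next Obligation.
move=> Q P q p X Y Z /=.
have nl := oplax_comult_nat q (oplax_comult p X Y) (idm (P Z)).
have nr := oplax_comult_nat q (idm (P X)) (oplax_comult p Y Z).
have ap := f_equal (fmap Q) (oplax_coassoc p X Y Z).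
have aq := oplax_coassoc q (P X) (P Y) (P Z).
move: nl nr ap aq; rewrite !fmap_comp !fmap_id -!compose_assoc => nl nr ap aq.
rewrite tensor_compl tensor_compr -!compose_assoc.
rewrite -(compose_swap nl) -(compose_swap nr) -ap.
by move: aq; rewrite !compose_assoc => ->.
Qed.
Next Obligation.
move=> Q P q p X /=.
have nl := oplax_comult_nat q (oplax_counit p) (idm (P X)).
have up := f_equal (fmap Q) (oplax_counitl p X).
move: nl up; rewrite !fmap_comp !fmap_id => nl up.
rewrite tensor_compl -!compose_assoc -(compose_swap nl) !compose_assoc.
by rewrite oplax_counitl -up.
Qed.
Next Obligation.
move=> Q P q p X /=.
have nr := oplax_comult_nat q (idm (P X)) (oplax_counit p).
have up := f_equal (fmap Q) (oplax_counitr p X).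
move: nr up; rewrite !fmap_comp !fmap_id => nr up.
rewrite tensor_compr -!compose_assoc -(compose_swap nr) !compose_assoc.
by rewrite oplax_counitr -up.
Qed.

Definition lax_transformation (F G : Functor C C)
    (f : LaxStructure F) (g : LaxStructure G) (t : NatTrans F G) : Prop :=
  t I ∘ lax_unit f = lax_unit g /\
  forall X Y, t (X ⊗ Y) ∘ lax_mult f X Y = lax_mult g X Y ∘ (t X [⊗] t Y).

Definition oplax_transformation (F G : Functor C C)
    (f : OplaxStructure F) (g : OplaxStructure G) (t : NatTrans F G) : Prop :=
  oplax_counit g ∘ t I = oplax_counit f /\
  forall X Y, oplax_comult g X Y ∘ t (X ⊗ Y) = (t X [⊗] t Y) ∘ oplax_comult f X Y.

Record MonoidalMonad (T : Monad C) := {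
  monoidal_lax :> LaxStructure T;
  monoidal_unit_lax : lax_transformation id_lax monoidal_lax (monad_unit T);
  monoidal_mult_lax :
    lax_transformation (comp_lax monoidal_lax monoidal_lax) monoidal_lax (monad_mult T)
}.

End LaxOplax.

Section Bilax.

Variables (C : Category) (B : BraidedStructure C).

Local Notation "X ⊗ Y" := (tensor B X Y).
Local Notation I := (tensor_unit B).
Local Notation "f [⊗] g" := (tensor_hom B f g) (at level 35).

(* [id_W ⊗ β_{X,Y} ⊗ id_Z] with the associators made explicit. *)
Definition middle_exchange (W X Y Z : C) :
    Hom ((W ⊗ X) ⊗ (Y ⊗ Z)) ((W ⊗ Y) ⊗ (X ⊗ Z)) :=
  assoc_inv B W Y (X ⊗ Z)
  ∘ (idm W [⊗] (assoc B Y X Z ∘ (braid B X Y [⊗] idm Z) ∘ assoc_inv B X Y Z))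
  ∘ assoc B W X (Y ⊗ Z).

(* The unit laws use [lunit I], which equals [runit I] by coherence. *)
Record BilaxStructure (P : Functor C C) := {
  bilax_lax : LaxStructure B P;
  bilax_oplax : OplaxStructure B P;
  bilax_bimonoidality : forall W X Y Z,
    oplax_comult bilax_oplax (W ⊗ Y) (X ⊗ Z) ∘ fmap P (middle_exchange W X Y Z)
      ∘ lax_mult bilax_lax (W ⊗ X) (Y ⊗ Z)
    = (lax_mult bilax_lax W Y [⊗] lax_mult bilax_lax X Z)
      ∘ middle_exchange (P W) (P X) (P Y) (P Z)
      ∘ (oplax_comult bilax_oplax W X [⊗] oplax_comult bilax_oplax Y Z);
  bilax_counit_unit :
    oplax_counit bilax_oplax ∘ lax_unit bilax_lax = idm I;
  bilax_comult_unit :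
    oplax_comult bilax_oplax I I ∘ fmap P (lunit_inv B I) ∘ lax_unit bilax_lax
    = (lax_unit bilax_lax [⊗] lax_unit bilax_lax) ∘ lunit_inv B I;
  bilax_counit_mult :
    oplax_counit bilax_oplax ∘ fmap P (lunit B I) ∘ lax_mult bilax_lax I I
    = lunit B I ∘ (oplax_counit bilax_oplax [⊗] oplax_counit bilax_oplax)
}.

Record BimonoidalMonad (T : Monad C) := {
  bimonoidal_bilax :> BilaxStructure T;
  bimonoidal_unit_lax :
    lax_transformation (id_lax B) (bilax_lax bimonoidal_bilax) (monad_unit T);
  bimonoidal_mult_lax :
    lax_transformation
      (comp_lax (bilax_lax bimonoidal_bilax) (bilax_lax bimonoidal_bilax))
      (bilax_lax bimonoidal_bilax) (monad_mult T);
  bimonoidal_unit_oplax :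
    oplax_transformation (id_oplax B) (bilax_oplax bimonoidal_bilax) (monad_unit T);
  bimonoidal_mult_oplax :
    oplax_transformation
      (comp_oplax (bilax_oplax bimonoidal_bilax) (bilax_oplax bimonoidal_bilax))
      (bilax_oplax bimonoidal_bilax) (monad_mult T)
}.

Definition forget_oplax (T : Monad C) (b : BimonoidalMonad T) :
    MonoidalMonad B T := {|
  monoidal_lax := bilax_lax b;
  monoidal_unit_lax := bimonoidal_unit_lax b;
  monoidal_mult_lax := bimonoidal_mult_lax b
|}.

End Bilax.

Arguments forget_oplax {C} B T b.

(* Finite products are a choice of a terminal object and of binary products. *)
Record FiniteProducts (C : Category) := {
  terminal : C;
  to_terminal : forall X, Hom X terminal;
  to_terminal_unique : forall X (f : Hom X terminal), f = to_terminal X;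
  prod_obj : C -> C -> C;
  prod_proj1 : forall X Y, Hom (prod_obj X Y) X;
  prod_proj2 : forall X Y, Hom (prod_obj X Y) Y;
  pairing : forall X Y Z, Hom Z X -> Hom Z Y -> Hom Z (prod_obj X Y);
  prod_proj1_pairing : forall X Y Z (f : Hom Z X) (g : Hom Z Y),
    prod_proj1 X Y ∘ pairing f g = f;
  prod_proj2_pairing : forall X Y Z (f : Hom Z X) (g : Hom Z Y),
    prod_proj2 X Y ∘ pairing f g = g;
  pairing_unique : forall X Y Z (f : Hom Z X) (g : Hom Z Y) (h : Hom Z (prod_obj X Y)),
    prod_proj1 X Y ∘ h = f -> prod_proj2 X Y ∘ h = g -> h = pairing f g
}.

Arguments prod_proj1 {C} _ {X Y}.
Arguments prod_proj2 {C} _ {X Y}.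
Arguments pairing {C} _ {X Y Z}.

Section Cartesian.

Variables (C : Category) (H : FiniteProducts C).

Local Notation "⟨ f , g ⟩" := (pairing H f g).
Local Notation π1 := (prod_proj1 H).
Local Notation π2 := (prod_proj2 H).

Lemma prod_ext X Y Z (f g : Hom Z (prod_obj H X Y)) :
  π1 ∘ f = π1 ∘ g -> π2 ∘ f = π2 ∘ g -> f = g.
Proof. by move=> e1 e2; rewrite (pairing_unique e1 e2) -(pairing_unique erefl erefl). Qed.

Lemma terminal_ext X (f g : Hom X (terminal H)) : f = g.
Proof. by rewrite (to_terminal_unique f) (to_terminal_unique g). Qed.

Lemma pairing_comp X Y Z W (f : Hom Z X) (g : Hom Z Y) (h : Hom W Z) :
  ⟨f, g⟩ ∘ h = ⟨f ∘ h, g ∘ h⟩.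
Proof. by apply: pairing_unique; rewrite compose_assoc (prod_proj1_pairing, prod_proj2_pairing). Qed.

Let prod_proj1_pairingA X Y Z W (f : Hom Z X) (g : Hom Z Y) (h : Hom W Z) :
  π1 ∘ (⟨f, g⟩ ∘ h) = f ∘ h.
Proof. by rewrite compose_assoc prod_proj1_pairing. Qed.

Let prod_proj2_pairingA X Y Z W (f : Hom Z X) (g : Hom Z Y) (h : Hom W Z) :
  π2 ∘ (⟨f, g⟩ ∘ h) = g ∘ h.
Proof. by rewrite compose_assoc prod_proj2_pairing. Qed.

Let compose_assocr (W X Y Z : C) (h : Hom Y Z) (g : Hom X Y) (f : Hom W X) :
  (h ∘ g) ∘ f = h ∘ (g ∘ f).
Proof. by rewrite compose_assoc. Qed.

Let prodE := (compose_assocr, prod_proj1_pairing, prod_proj2_pairing,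
              prod_proj1_pairingA, prod_proj2_pairingA, compose_idl, compose_idr).

Ltac solve_prod :=
  intros; cbn beta;
  repeat (rewrite ?prodE; first [done | exact: terminal_ext | apply: prod_ext]).

Program Definition cartesian_monoidal : MonoidalStructure C := {|
  tensor := prod_obj H;
  tensor_hom := fun X X' Y Y' f g => ⟨f ∘ π1, g ∘ π2⟩;
  tensor_unit := terminal H;
  assoc := fun X Y Z => ⟨π1 ∘ π1, ⟨π2 ∘ π1, π2⟩⟩;
  assoc_inv := fun X Y Z => ⟨⟨π1, π1 ∘ π2⟩, π2 ∘ π2⟩;
  lunit := fun X => π2;
  lunit_inv := fun X => ⟨to_terminal H X, idm X⟩;
  runit := fun X => π1;
  runit_inv := fun X => ⟨idm X, to_terminal H X⟩
|}.
Solve All Obligations with solve_prod.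

Program Definition cartesian_braided : BraidedStructure C := {|
  braided_monoidal := cartesian_monoidal;
  braid := fun X Y => ⟨π2, π1⟩;
  braid_inv := fun X Y => ⟨π2, π1⟩
|}.
Solve All Obligations with solve_prod.

Program Definition cartesian_symmetric : SymmetricStructure C := {|
  symmetric_braided := cartesian_braided
|}.
Solve All Obligations with solve_prod.

End Cartesian.

Definition affine (C : Category) (H : FiniteProducts C) (P : Functor C C) : Prop :=
  isomorphic (P (terminal H)) (terminal H).

(* Main.v *)
Require Import Defs.
From mathcomp Require Import ssreflect ssrfun.
From Stdlib Require Import ProofIrrelevance FunctionalExtensionality.

(** Every endofunctor [P] of a cartesian category carries exactly one oplax
    structure.  Naturality of [Δ] along [X -> 1] and [Y -> 1] together with the
    counit laws forces [Δ = ⟨P π1, P π2⟩], and [ε] is the map to the terminal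
    object.  All axioms involving [ε] and [Δ] then follow from naturality and
    from the universal properties of products and of the terminal object. *)

Set Implicit Arguments.
Unset Strict Implicit.
Unset Printing Implicit Defensive.

#[local] Obligation Tactic := idtac.

Lemma oplax_eq (C : Category) (M : MonoidalStructure C) (P : Functor C C)
    (p q : OplaxStructure M P) :
  oplax_counit p = oplax_counit q -> oplax_comult p = oplax_comult q -> p = q.
Proof.
case: p => e d ? ? ? ?; case: q => e' d' ? ? ? ? /= ee ed.
by subst e' d'; f_equal; exact: proof_irrelevance.
Qed.

Section CanonicalOplax.

Variables (C : Category) (H : FiniteProducts C).

Local Notation "⟨ f , g ⟩" := (pairing H f g).
Local Notation π1 := (prod_proj1 H).
Local Notation π2 := (prod_proj2 H).
Local Notation M := (cartesian_monoidal H).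
Local Notation B := (symmetric_braided (cartesian_symmetric H)).

Let proj1A X Y Z W (f : Hom Z X) (g : Hom Z Y) (h : Hom W Z) :
  π1 ∘ (⟨f, g⟩ ∘ h) = f ∘ h.
Proof. by rewrite compose_assoc prod_proj1_pairing. Qed.

Let proj2A X Y Z W (f : Hom Z X) (g : Hom Z Y) (h : Hom W Z) :
  π2 ∘ (⟨f, g⟩ ∘ h) = g ∘ h.
Proof. by rewrite compose_assoc prod_proj2_pairing. Qed.

Let compA (W X Y Z : C) (h : Hom Y Z) (g : Hom X Y) (f : Hom W X) :
  (h ∘ g) ∘ f = h ∘ (g ∘ f).
Proof. by rewrite compose_assoc. Qed.

Let fmapA (P : Functor C C) W X Y Z (g : Hom Y Z) (f : Hom X Y) (h : Hom W (P X)) :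
  fmap P g ∘ (fmap P f ∘ h) = fmap P (g ∘ f) ∘ h.
Proof. by rewrite fmap_comp compA. Qed.

Let prodE := (compA, prod_proj1_pairing, prod_proj2_pairing, proj1A, proj2A,
              compose_idl, compose_idr).

Let fmapV (P : Functor C C) X Y Z (g : Hom Y Z) (f : Hom X Y) :
  fmap P g ∘ fmap P f = fmap P (g ∘ f).
Proof. by rewrite fmap_comp. Qed.

(** Alternates between normalising composites (right-nested, adjacent [fmap]s fused) and testing on
    both projections, until the sides coincide or the target is terminal. *)
Ltac solve_oplax :=
  intros; cbn;
  repeat (rewrite ?(prodE, fmapA, fmapV, fmap_id);
          first [done | exact: terminal_ext | apply: prod_ext]).

Program Definition cartesian_oplax (P : Functor C C) : OplaxStructure M P := {|
  oplax_counit := to_terminal H (P (terminal H));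
  oplax_comult := fun X Y => ⟨fmap P π1, fmap P π2⟩
|}.
Next Obligation. by solve_oplax. Qed.
Next Obligation. by solve_oplax. Qed.
Next Obligation. by solve_oplax. Qed.
Next Obligation. by solve_oplax. Qed.

(** Since [runit] is [π1] here, the right counit law is already the claim for [Y] terminal. *)
Lemma oplax_proj1 (P : Functor C C) (p : OplaxStructure M P) X Y :
  π1 ∘ oplax_comult p X Y = fmap P π1.
Proof.
have n := oplax_comult_nat p (idm X) (to_terminal H Y).
move: (oplax_counitr p X) => /= u.
(* Tensoring with [Y -> 1] does not affect the first component, so [Y] can be replaced by the
   terminal object. *)
transitivity (π1 ∘ (oplax_comult p X (terminal H)
   ∘ fmap P (tensor_hom M (idm X) (to_terminal H Y)))).
  by rewrite n /= !prodE fmap_id compose_idl.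
move: u; rewrite !prodE compose_assoc => ->.
by rewrite -fmap_comp /= !prodE.
Qed.

Lemma oplax_proj2 (P : Functor C C) (p : OplaxStructure M P) X Y :
  π2 ∘ oplax_comult p X Y = fmap P π2.
Proof.
have n := oplax_comult_nat p (to_terminal H X) (idm Y).
move: (oplax_counitl p Y) => /= u.
transitivity (π2 ∘ (oplax_comult p (terminal H) Y
   ∘ fmap P (tensor_hom M (to_terminal H X) (idm Y)))).
  by rewrite n /= !prodE fmap_id compose_idl.
move: u; rewrite !prodE compose_assoc => ->.
by rewrite -fmap_comp /= !prodE.
Qed.

Lemma cartesian_oplax_unique (P : Functor C C) (p : OplaxStructure M P) :
  p = cartesian_oplax P.
Proof.
apply: oplax_eq; first exact: terminal_ext.
apply: functional_extensionality_dep => X.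
apply: functional_extensionality_dep => Y.
by apply: pairing_unique; [exact: oplax_proj1 | exact: oplax_proj2].
Qed.

(** Being a tensor of maps, the right-hand side can be moved across [∇] by naturality. *)
Lemma middle_exchange_proj1 (W X Y Z : C) :
  π1 ∘ middle_exchange B W X Y Z = tensor_hom M π1 π1.
Proof. by rewrite /middle_exchange; solve_oplax. Qed.

Lemma middle_exchange_proj2 (W X Y Z : C) :
  π2 ∘ middle_exchange B W X Y Z = tensor_hom M π2 π2.
Proof. by rewrite /middle_exchange; solve_oplax. Qed.

Program Definition cartesian_bilax (P : Functor C C) (p : LaxStructure M P) :
    BilaxStructure B P := {|
  bilax_lax := p;
  bilax_oplax := cartesian_oplax P
|}.
Next Obligation.
move=> P p W X Y Z.
(* Bimonoidality, one component at a time: naturality of [∇] at a pair of projections makes [∇] the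
   last factor on both sides, and only maps between products remain to be compared. *)
apply: prod_ext; rewrite /= !prodE fmapA.
- rewrite middle_exchange_proj1 -(lax_mult_nat p) /=; congr (_ ∘ _).
  by solve_oplax.
- rewrite middle_exchange_proj2 -(lax_mult_nat p) /=; congr (_ ∘ _).
  by solve_oplax.
Qed.
Next Obligation. by move=> P p; exact: terminal_ext. Qed.
Next Obligation.
move=> P p.
apply: prod_ext; rewrite /= !prodE fmapA !prodE.
(* The first component of [lunit_inv] at the unit object is a map [1 -> 1], hence the identity. *)
- by rewrite (terminal_ext (to_terminal H _) (idm _)) fmap_id compose_idl compose_idr.
- by rewrite fmap_id compose_idl.
Qed.
Next Obligation. by move=> P p; exact: terminal_ext. Qed.

(** Each component of the comultiplication square is naturality of the monad unit at a
    projection. *)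
Lemma cartesian_oplax_unit (T : Monad C) :
  oplax_transformation (id_oplax M) (cartesian_oplax T) (monad_unit T).
Proof.
split=> [|X Y]; first exact: terminal_ext.
by apply: prod_ext; rewrite /= !prodE -(naturality (monad_unit T)).
Qed.

Lemma cartesian_oplax_mult (T : Monad C) :
  oplax_transformation (comp_oplax (cartesian_oplax T) (cartesian_oplax T))
    (cartesian_oplax T) (monad_mult T).
Proof.
split=> [|X Y]; first exact: terminal_ext.
by apply: prod_ext;
  rewrite /= !prodE -(naturality (monad_mult T)) /= -fmap_comp !prodE.
Qed.

Definition cartesian_bimonoidal (T : Monad C) (m : MonoidalMonad M T) :
    BimonoidalMonad B T := {|
  bimonoidal_bilax := cartesian_bilax (monoidal_lax m);
  bimonoidal_unit_lax := monoidal_unit_lax m;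
  bimonoidal_mult_lax := monoidal_mult_lax m;
  bimonoidal_unit_oplax := cartesian_oplax_unit T;
  bimonoidal_mult_oplax := cartesian_oplax_mult T
|}.

(** The core of injectivity: both oplax parts are the canonical one, and the laws agree by proof
    irrelevance. *)
Lemma cartesian_bilax_eq (P : Functor C C) (b c : BilaxStructure B P) :
  bilax_lax b = bilax_lax c -> b = c.
Proof.
case: b => l o ? ? ? ?; case: c => l' o' ? ? ? ? /= el.
have eo : o = o' by rewrite (cartesian_oplax_unique o) -(cartesian_oplax_unique o').
by subst l' o'; f_equal; exact: proof_irrelevance.
Qed.

Lemma cartesian_bimonoidal_eq (T : Monad C) (b c : BimonoidalMonad B T) :
  bilax_lax b = bilax_lax c -> b = c.
Proof.
case: b => x ? ? ? ?; case: c => y ? ? ? ? /= /cartesian_bilax_eq exy.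
by subst y; f_equal; exact: proof_irrelevance.
Qed.

End CanonicalOplax.

Theorem proposition3p4 (C : Category) (H : FiniteProducts C) (T : Monad C)
    (T_affine : affine H T) :
  bijective (forget_oplax (cartesian_symmetric H) T).
Proof.
(* The inverse adjoins the canonical oplax structure. It keeps the lax part, so the other round trip
   holds by computation once [m] is destructed. *)
exists (@cartesian_bimonoidal C H T) => [b|m]; first exact: cartesian_bimonoidal_eq.
by case: m.
Qed.
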